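(* Let $V$ be a $C_2$ co-finite vertex operator algebra of CFT type, let $M$ be an irreducible weak $V$-module, and let $n\ge 0$ be an integer. If $M$ is $C_2$ co-finite, then $A_n(M)$ is finite dimensional.
   Context: A vertex operator algebra $V=(V,Y,\mathbf 1,\omega)$ (over $\mathbb C$, with $Y(u,z)=\sum_{n\in\mathbb Z}u_nz^{-n-1}$) is of CFT type if its weight decomposition is $V=\bigoplus_{n\ge 0}V(n)$ with $V(0)=\mathbb C\mathbf 1$; write $\mathrm{wt}(v)=n$ for $v\in V(n)$. $C_2(V)$ is the linear span of $\{u_{-2}v: u,v\in V\}$, and $V$ is $C_2$ co-finite if $V/C_2(V)$ is finite dimensional. A weak $V$-module is a vector space $M$ with a linear map $Y_M:V\to \mathrm{End}(M)[[z,z^{-1}]]$, $v\mapsto Y_M(v,z)=\sum_{n\in\mathbb Z}v_nz^{-n-1}$, such that $v_nm=0$ for $n\gg 0$ (for each $v\in V$, $m\in M$), $Y_M(\mathbf 1,z)=\mathrm{Id}_M$, and the Jacobi identity holds; no grading is assumed. $M$ is $C_2$ co-finite if $M/C_2(M)$ is finite dimensional, where $C_2(M)$ is the linear span of $\{v_{-2}m: v\in V, m\in M\}$. For homogeneous $u\in V$ and $m\in M$ put $$u\circ_n m=\mathrm{Res}_z\, Y_M(u,z)m\,\frac{(1+z)^{\mathrm{wt}(u)+n}}{z^{2n+2}}=\sum_{j\ge 0}\binom{\mathrm{wt}(u)+n}{j}u_{j-2n-2}m,$$ extended linearly in $u$ to all of $V$. $O_n(M)$ is the linear span of $\{u\circ_n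 m: u\in V, m\in M\}$ and $A_n(M)=M/O_n(M)$. *)

(* Defs.v *)
From HB Require Import structures.
From mathcomp Require Import all_boot all_order all_algebra generic_quotient.
From mathcomp Require Import boolp classical_sets cardinality fsbigop reals.
From mathcomp.real_closed Require Import complex.

Set Implicit Arguments.
Unset Strict Implicit.
Unset Printing Implicit Defensive.

Import Order.TTheory GRing.Theory Num.Theory.

Local Open Scope classical_set_scope.
Local Open Scope quotient_scope.
Local Open Scope ring_scope.

(* Possibly infinite-dimensional linear algebra.  The library's vectType and
   span only cover the finite-dimensional case. *)
Section LinearAlgebra.
Variables (K : fieldType) (E : lmodType K).

Definition lspan (A : set E) : {pred E} := fun x =>
  `[< exists (d : nat) (a : 'I_d -> K) (e : 'I_d -> E),
        (forall i, A (e i)) /\ x = \sum_i a i *: e i >].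

Lemma lspan_submod (A : set E) : submod_closed (lspan A).
Proof.
split; first by apply/asboolP; exists 0, (fun=> 0), (fun=> 0); rewrite big_ord0;
  split=> // -[].
move=> c _ _ /asboolP[d [a [e [Ae ->]]]] /asboolP[d' [a' [e' [Ae' ->]]]].
apply/asboolP; exists (d + d')%N.
exists (fun i => match split i with inl j => c * a j | inr j => a' j end).
exists (fun i => match split i with inl j => e j | inr j => e' j end).
split=> [i|]; first by case: split.
rewrite big_split_ord /= scaler_sumr; congr (_ + _); apply: eq_bigr => i _.
- by rewrite (unsplitK (inl i)) scalerA.
- by rewrite (unsplitK (inr i)).
Qed.

HB.instance Definition _ (A : set E) :=
  GRing.isSubSemiModClosed.Build K E (lspan A)
    (GRing.submod_closed_semi (lspan_submod A)).

Definition fin_dim : Prop :=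
  exists (d : nat) (e : 'I_d -> E),
    forall x, exists a : 'I_d -> K, x = \sum_i a i *: e i.

End LinearAlgebra.

(* The library's {quot I} is only a zmodType; lquot I is the same quotient with
   the induced scalar multiplication. *)
Section LinearQuotient.
Variables (K : fieldType) (E : lmodType K) (I : submodClosed E).

(* submodClosed only records closure under + and scaling; Quotient.quot asks
   for a zmodClosed. *)
Definition as_zmod : {pred E} := I.

Lemma as_zmod_closed : zmod_closed as_zmod.
Proof.
split; first exact: (rpred0 I).
move=> x y xI yI; rewrite -scaleN1r.
by apply: (@rpredD _ I) => //; apply: (@rpredZ _ _ I).
Qed.

HB.instance Definition _ := GRing.isZmodClosed.Build E as_zmod as_zmod_closed.

Definition lquot := Quotient.quot as_zmod.
HB.instance Definition _ := GRing.Zmodule.on lquot.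

Definition lproj (x : E) : lquot := \pi_(Quotient.quot as_zmod) x.

Lemma lproj_eq x y : (lproj x = lproj y) <-> (x - y \in I).
Proof.
by rewrite -[x - y \in I]/(x - y \in as_zmod) Quotient.idealrBE; split=> /eqP.
Qed.

Lemma lprojK (q : lquot) : lproj (repr (q : Quotient.quot as_zmod)) = q.
Proof. exact: reprK. Qed.

Lemma lprojD x y : lproj (x + y) = lproj x + lproj y.
Proof. exact: (Quotient.pi_add as_zmod x y). Qed.

Definition lquot_scale (a : K) (q : lquot) : lquot :=
  lproj (a *: repr (q : Quotient.quot as_zmod)).

Lemma lproj_scale a x : lproj (a *: x) = lquot_scale a (lproj x).
Proof.
by apply/lproj_eq; rewrite -scalerBr rpredZ //; apply/lproj_eq; rewrite lprojK.
Qed.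

Lemma lquot_scaleA a b q :
  lquot_scale a (lquot_scale b q) = lquot_scale (a * b) q.
Proof. by rewrite -[q]lprojK -!lproj_scale scalerA. Qed.

Lemma lquot_scale1 : left_id 1 lquot_scale.
Proof. by move=> q; rewrite -[q]lprojK -lproj_scale scale1r. Qed.

Lemma lquot_scaleDr : right_distributive lquot_scale +%R.
Proof.
move=> a q r; rewrite -[q]lprojK -[r]lprojK -lprojD -!lproj_scale.
by rewrite scalerDr lprojD.
Qed.

Lemma lquot_scaleDl q : {morph lquot_scale^~ q : a b / a + b}.
Proof.
by move=> a b; rewrite -[q]lprojK -!lproj_scale scalerDl lprojD.
Qed.

HB.instance Definition _ := GRing.Zmodule_isLmodule.Build K lquot
  lquot_scaleA lquot_scale1 lquot_scaleDr lquot_scaleDl.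

End LinearQuotient.

Definition binz (K : fieldType) (k : int) (j : nat) : K :=
  (\prod_(i < j) (k - i%:Z)%:~R) / (j`!)%:R.

(* A field Y(u,z) = \sum_n u_n z^(-n-1) is given by its modes: act u n is u_n. *)
Section Modes.
Variables (K : fieldType) (V M : lmodType K).
Variables (Y : V -> int -> V -> V) (act : V -> int -> M -> M).

Definition bilinear_modes : Prop :=
  (forall u n, linear (act u n)) /\ (forall n w, linear (fun u => act u n w)).

Definition truncation : Prop :=
  forall u w, exists N : int, forall n : int, N <= n -> act u n w = 0.

Definition identity_field (one : V) : Prop :=
  forall n w, act one n w = if n == -1 then w else 0.

(* The coefficient of z0^(-l-1) z1^(-m-1) z2^(-n-1) in
     z0^-1 delta((z1 - z2)/z0) Y(u,z1) Y(v,z2) w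
       - z0^-1 delta((z2 - z1)/(- z0)) Y(v,z2) Y(u,z1) w
     = z2^-1 delta((z1 - z0)/z2) Y(Y(u,z0)v, z2) w.
   Both sums have finite support by truncation; \sum_(i \in setT) is 0 on
   families of infinite support, so this is meant together with truncation. *)
Definition jacobi_identity : Prop :=
  forall (u v : V) (w : M) (l m n : int),
    \sum_(i \in [set: nat])
      ((-1) ^+ i * binz K l i) *:
        (act u (m + l - i%:Z) (act v (n + i%:Z) w)
         - (-1) ^ l *: act v (n + l - i%:Z) (act u (m + i%:Z) w))
    = \sum_(i \in [set: nat])
        binz K m i *: act (Y u (l + i%:Z) v) (m + n - i%:Z) w.

End Modes.

Record voa (R : realType) := Voa {
  voa_space :> lmodType R[i];
  mode : voa_space -> int -> voa_space -> voa_space;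
  vac : voa_space;
  conformal : voa_space;
  central_charge : R[i];
  (* L(k) = omega_(k+1), weight spaces = eigenspaces of L(0) *)
  voa_L := fun k : int => mode conformal (k + 1);
  voa_homog := fun k : int => [set v | voa_L 0 v = k%:~R *: v];
  mode_bilinear : bilinear_modes mode;
  mode_truncation : truncation mode;
  mode_vac : identity_field mode vac;
  mode_creation : forall v, mode v (-1) vac = v /\
    forall n : int, 0 <= n -> mode v n vac = 0;
  mode_jacobi : jacobi_identity mode mode;
  voa_virasoro : forall (m n : int) v,
    voa_L m (voa_L n v) - voa_L n (voa_L m v) =
      (m - n)%:~R *: voa_L (m + n) v
      + (if m + n == 0
         then ((m ^+ 3 - m)%:~R / 12%:R * central_charge) *: v else 0);
  (* Y(L(-1)v, z) = d/dz Y(v,z) *)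
  voa_derivative : forall v (n : int) w,
    mode (voa_L (-1) v) n w = (- n)%:~R *: mode v (n - 1) w;
  (* V is the sum of its weight spaces; the sum is direct, see homog_sum_eq0 *)
  voa_grading : forall v, exists f : int -> voa_space,
    [/\ finite_set [set k | f k <> 0], forall k, voa_homog k (f k)
      & v = \sum_(k \in [set: int]) f k];
  voa_homog_fin_dim : forall k, exists (d : nat) (e : 'I_d -> voa_space),
    voa_homog k = [set` lspan (range e)];
  voa_homog_bounded : exists N : int, forall k v,
    k < N -> voa_homog k v -> v = 0
}.

Definition cft_type (R : realType) (V : voa R) : Prop :=
  (forall (k : int) (v : V), k < 0 -> voa_homog k v -> v = 0) /\
  (voa_homog 0 = [set v : V | exists a : R[i], v = a *: vac V]).

Record weak_module (R : realType) (V : voa R) := WeakModule {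
  wm_space :> lmodType R[i];
  act : V -> int -> wm_space -> wm_space;
  act_bilinear : bilinear_modes act;
  act_truncation : truncation act;
  act_vac : identity_field act (vac V);
  act_jacobi : jacobi_identity (@mode R V) act
}.

Section Notions.
Variables (R : realType) (V : voa R).

Definition adjoint : weak_module V :=
  WeakModule (@mode_bilinear R V) (@mode_truncation R V) (@mode_vac R V)
             (@mode_jacobi R V).

Definition irreducible (M : weak_module V) : Prop :=
  (exists w : M, w <> 0) /\
  forall W : {pred M},
    submod_closed W ->
    (forall (v : V) (n : int) (w : M), w \in W -> act v n w \in W) ->
    (forall w, w \in W -> w = 0) \/ (forall w, w \in W).

Definition C2 (M : weak_module V) : submodClosed M :=
  lspan [set x : M | exists (v : V) (w : M), x = act v (-2) w].

Definition C2_cofinite (M : weak_module V) : Prop := fin_dim (lquot (C2 M)).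

Definition homog_comp (k : int) (v : V) : V := projT1 (cid (voa_grading v)) k.

Lemma homog_sum_eq0 (s : seq int) (f : int -> V) :
  uniq s -> (forall k, voa_homog k (f k)) -> \sum_(k <- s) f k = 0 ->
  forall k, k \in s -> f k = 0.
Proof.
pose D a : V -> V := fun v => voa_L 0 v - a%:~R *: v.
have linL : linear (@voa_L R V 0) by exact: (mode_bilinear V).1.
have L0 : voa_L 0 (0 : V) = 0.
  by have := linL (-1) 0 0; rewrite !scaler0 !addr0 scaleN1r addNr.
have LD (x y : V) : voa_L 0 (x + y) = voa_L 0 x + voa_L 0 y.
  by have := linL 1 x y; rewrite !scale1r.
have LZ a (x : V) : voa_L 0 (a *: x) = a *: voa_L 0 x.
  by have := linL a x 0; rewrite !addr0 L0 addr0.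
elim: s f => [//|a s IH] f /=/andP[aNs us] hf.
rewrite big_cons => sum0.
have D0 : D a 0 = 0 by rewrite /D L0 scaler0 subr0.
have DD x y : D a (x + y) = D a x + D a y.
  by rewrite /D LD scalerDr opprD addrACA.
have Df k : D a (f k) = (k - a)%:~R *: f k.
  by rewrite /D (hf k) -scalerBl intrB.
have Dsum t : D a (\sum_(k <- t) f k) = \sum_(k <- t) (k - a)%:~R *: f k.
  elim: t => [|b t IHt]; first by rewrite !big_nil D0.
  by rewrite !big_cons DD IHt Df.
have fs k : k \in s -> f k = 0.
  move=> ks; have : (k - a)%:~R *: f k = 0.
    apply: (IH (fun k => (k - a)%:~R *: f k)) => // [j|].
      by rewrite /voa_homog /= LZ (hf j) !scalerA mulrC.
    have := DD (f a) (\sum_(k <- s) f k).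
    by rewrite sum0 D0 Df subrr scale0r add0r Dsum => <-.
  move/eqP; rewrite scaler_eq0 intr_eq0 subr_eq0 => /orP[/eqP ka|/eqP//].
  by rewrite -ka ks in aNs.
move=> k; rewrite inE => /orP[/eqP ->|/fs//].
by move: sum0; rewrite big_seq big1 ?addr0.
Qed.

Lemma homog_compE (k : int) (v : V) : voa_homog k v ->
  forall j, homog_comp j v = if j == k then v else 0.
Proof.
move=> hv j; rewrite /homog_comp; case: cid => f /= [finf hf vE].
pose g i := f i - (if i == k then v else 0).
apply/eqP; rewrite -subr_eq0; apply/eqP; rewrite -/(g j).
have /finite_seqP[t tE] := finf.
pose s := undup (j :: k :: t).
have us : uniq s by exact: undup_uniq.
apply: (homog_sum_eq0 us); last by rewrite mem_undup inE eqxx.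
- move=> i; rewrite /g; case: eqP => [->|_]; last by rewrite subr0.
  have linL : linear (@voa_L R V 0) by exact: (mode_bilinear V).1.
  have LE : voa_L 0 (f k - v) = voa_L 0 (f k) - voa_L 0 v.
    by rewrite addrC -scaleN1r linL scaleN1r addrC.
  by rewrite /voa_homog /= LE (hf k) hv scalerBr.
- have ks : k \in s by rewrite mem_undup !inE eqxx orbT.
  rewrite /g sumrB (bigD1_seq k ks us) /= [X in _ - X](bigD1_seq k ks us) /=.
  rewrite eqxx [X in _ - (v + X)]big1 ?addr0 => [|i /negPf ->//].
  rewrite -(bigD1_seq k ks us) /= vE (fsbigE s) //; last first.
    move=> i _; rewrite mem_undup !inE !negb_or => /and3P[_ _].
    move=> it; apply: contrapT => fi0; move/negP: it; apply.
    by have : [set i | f i <> 0] i by []; rewrite tE.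
  by rewrite [X in _ - X](eq_bigl predT) ?subrr // => i; rewrite in_setT.
Qed.

(* The inner sum is Res_z Y_M(u_k,z)w (1+z)^(k+n) / z^(2n+2), where u_k is the
   component of weight k of u; see circ_homog. *)
Definition circ (M : weak_module V) (n : nat) (u : V) (w : M) : M :=
  \sum_(k \in [set: int]) \sum_(j \in [set: nat])
    binz R[i] (k + n%:Z) j *: act (homog_comp k u) (j%:Z - (2 * n + 2)%:Z) w.

Lemma circ_homog (M : weak_module V) (n : nat) (k : int) (u : V) (w : M) :
  voa_homog k u ->
  circ n u w = \sum_(j \in [set: nat])
    binz R[i] (k + n%:Z) j *: act u (j%:Z - (2 * n + 2)%:Z) w.
Proof.
move=> hu; have act0 j : act (0 : V) j w = 0.
  have := (act_bilinear M).2 j w (-1) 0 0.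
  by rewrite scaler0 addr0 scaleN1r addNr.
rewrite /circ (fsbigE [:: k]) // => [|i _ ik].
  rewrite big_cons big_nil in_setT /= addr0.
  by apply: eq_fsbigr => j _; rewrite (homog_compE hu) eqxx.
rewrite fsbig1 // => j _; rewrite (homog_compE hu).
by move: ik; rewrite inE => /negPf ->; rewrite act0 scaler0.
Qed.

Definition O_ (n : nat) (M : weak_module V) : submodClosed M :=
  lspan [set x : M | exists (u : V) (w : M), x = circ n u w].

Definition A_ (n : nat) (M : weak_module V) := lquot (O_ n M).

End Notions.

(* Main.v *)
(* Fix a nonzero vector w of M and a finite set A of homogeneous vectors that
   spans V modulo C_2(V).  Following Miyamoto, every word u^1_{i_1}...u^k_{i_k} w
   in homogeneous vectors is a combination of words of the same degree
   sum_j (wt u^j - i_j - 1) with u^j in A and i_1 < ... < i_k.  The induction is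
   on the total weight sum_j wt u^j: commutators, and modes of elements y_{-2}z,
   have lower total weight, so modulo lower weight the letters commute and lie
   in A.  A repeated index a_r b_r is removed through the (2r+1)-st mode of
   a_{-1}b, which is the sum of the products a_i b_j with i + j = 2r up to order:
   that mode gives a shorter word, and the other products spread the indices
   further apart, which stops because a letter of large index kills w.

   Increasing words then have degree bounded below, although M carries no
   grading.  Since u o_n m is u_{-2n-2} m plus terms of lower degree, induction
   on the degree shows that the finitely many increasing words with all indices
   above -2n-2 span M modulo O_n(M). *)
Require Import Defs.
From HB Require Import structures.
From mathcomp Require Import all_boot all_order all_algebra generic_quotient.
From mathcomp Require Import boolp classical_sets cardinality fsbigop reals.
From mathcomp.real_closed Require Import complex.
From mathcomp Require Import zify ring.

Set Implicit Arguments.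
Unset Strict Implicit.
Unset Printing Implicit Defensive.

Import Order.TTheory GRing.Theory Num.Theory.

Local Open Scope classical_set_scope.
Local Open Scope ring_scope.

(** * Linear spans and finite-dimensional quotients *)

Section Span.
Variables (K : fieldType) (E : lmodType K).
Implicit Types (A : set E).

Lemma lspan_gen A x : A x -> x \in lspan A.
Proof.
move=> Ax; apply/asboolP; exists 1%N, (fun=> 1), (fun=> x).
by split=> //; rewrite big_ord1 scale1r.
Qed.

Lemma lspan_lin (E' : lmodType K) (f : E -> E') A (I : submodClosed E') :
  linear f -> (forall x, A x -> f x \in I) ->
  forall x, x \in lspan A -> f x \in I.
Proof.
move=> flin Af _ /asboolP[d [a [e [Ae ->]]]].
pose F : {linear E -> E'} := HB.pack f (GRing.isLinear.Build K E E' _ f flin).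
rewrite -[f]/(F : E -> E') linear_sum; apply: rpred_sum => i _.
by rewrite linearZ rpredZ // Af.
Qed.

Lemma lspan_sub A (I : submodClosed E) :
  (forall x, A x -> x \in I) -> forall x, x \in lspan A -> x \in I.
Proof. by move=> AI x; apply: (@lspan_lin E id). Qed.

Lemma fsbig_nat_ord (F : nat -> E) (N : nat) :
  (forall i, (N <= i)%N -> F i = 0) ->
  \sum_(i \in [set: nat]) F i = \sum_(i < N) F i.
Proof.
move=> F0; rewrite (fsbigE (iota 0 N)) ?iota_uniq //=.
- rewrite (eq_bigl predT) => [|i]; last by rewrite in_setT.
  by rewrite -[in RHS](big_mkord predT) /index_iota subn0.
- by move=> i _; rewrite mem_iota /= add0n -leqNgt => /F0.
Qed.

Lemma submodB (I : submodClosed E) x y : x \in I -> y \in I -> x - y \in I.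
Proof. by move=> Ix Iy; rewrite -scaleN1r; apply/rpredD/rpredZ. Qed.

Lemma submod_congr (I : submodClosed E) x y :
  x - y \in I -> (x \in I) = (y \in I).
Proof.
move=> Ixy; apply/idP/idP => [Ix|Iy]; last by rewrite -(subrK y x) rpredD.
by rewrite -(subKr x y) submodB.
Qed.

Lemma lproj_linear (I : submodClosed E) : linear (lproj I).
Proof. by move=> a x y; rewrite lprojD lproj_scale. Qed.

Lemma lproj_sum (I : submodClosed E) (d : nat) (a : 'I_d -> K) (e : 'I_d -> E) :
  lproj I (\sum_i a i *: e i) = \sum_i a i *: lproj I (e i).
Proof.
pose F : {linear E -> lquot I} :=
  HB.pack (lproj I) (GRing.isLinear.Build K E _ _ _ (@lproj_linear I)).
rewrite -[LHS]/(F _) linear_sum; apply: eq_bigr => i _; exact: linearZ.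
Qed.

Lemma lspan_setU A d (e : 'I_d -> E) x :
  x \in lspan (A `|` range e) ->
  exists c : 'I_d -> K, x - \sum_i c i *: e i \in lspan A.
Proof.
move=> /asboolP[m [a [f [Af ->]]]].
elim: m a f Af => [|m IH] a f Af.
  exists (fun=> 0); rewrite big_ord0 big1 ?subr0 ?rpred0 // => i _.
  by rewrite scale0r.
have [i|c hc] := IH (a \o lift ord0) (f \o lift ord0); first exact: Af.
rewrite big_ord_recl; case: (Af ord0) => [Af0|[j _ <-]].
  by exists c; rewrite -addrA rpredD // rpredZ // lspan_gen.
exists (fun i => c i + (i == j)%:R * a ord0).
suff -> : \sum_i (c i + (i == j)%:R * a ord0) *: e i =
          a ord0 *: e j + \sum_i c i *: e i.
  by rewrite opprD addrACA subrr add0r.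
under eq_bigr do rewrite scalerDl.
rewrite big_split /= addrC; congr (_ + _).
rewrite (bigD1 j) //= eqxx mul1r big1 ?addr0 // => i /negPf->.
by rewrite mul0r scale0r.
Qed.

Lemma fin_dim_lquot A (s : seq E) :
  (forall x, x \in lspan (A `|` [set` s])) -> fin_dim (lquot (lspan A)).
Proof.
move=> span; pose e (i : 'I_(size s)) := s`_i.
exists (size s), (fun i => lproj (lspan A) (e i)) => q.
have [|c hc] := @lspan_setU A _ e (repr (q : Quotient.quot (as_zmod (lspan A)))).
  apply: lspan_sub (span _) => x [Ax|sx]; apply: lspan_gen; first by left.
  by right; have /(nthP 0)[i ilt <-] := sx; exists (Ordinal ilt).
by exists c; rewrite -lproj_sum -(lprojK q); apply/lproj_eq.
Qed.

Lemma fin_dim_lquotP (I : submodClosed E) : fin_dim (lquot I) ->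
  exists (d : nat) (e : 'I_d -> E),
    forall x, exists c : 'I_d -> K, x - \sum_i c i *: e i \in I.
Proof.
move=> [d [e span]].
exists d, (fun i => repr (e i : Quotient.quot (as_zmod I))) => x.
have [c xE] := span (lproj I x); exists c; apply/lproj_eq.
by rewrite xE lproj_sum; apply: eq_bigr => i _; rewrite lprojK.
Qed.
End Span.

(** * Binomial coefficients with integer upper entry *)

Section Binomial.
Variable K : numFieldType.

Lemma binz0 k : binz K k 0 = 1.
Proof. by rewrite /binz big_ord0 divr1. Qed.

Lemma binz0l j : binz K 0 j = (j == 0)%:R.
Proof.
case: j => [|j]; first exact: binz0.
by rewrite /binz big_ord_recl subrr mul0r mul0r.
Qed.

Lemma binz1 k : binz K k 1 = k%:~R.
Proof. by rewrite /binz big_ord1 subr0 divr1. Qed.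

(** Up to sign this is the binomial coefficient of [t + j] over [j]: all factors of the numerator
    are negative integers. *)
Lemma binz_neg_neq0 t j : binz K (- 1 - t%:Z) j != 0.
Proof.
rewrite /binz mulf_neq0 ?invr_eq0 ?pnatr_eq0 -?lt0n ?fact_gt0 //.
by apply/prodf_neq0 => i _; rewrite intr_eq0; lia.
Qed.

Lemma binzN1 j : (-1) ^+ j * binz K (-1) j = 1.
Proof.
rewrite /binz; have -> : \prod_(i < j) (-1 - i%:Z)%:~R = (-1) ^+ j * j`!%:R :> K.
  elim: j => [|j IH]; first by rewrite big_ord0 mul1r.
  rewrite big_ord_recr IH factS natrM exprS /=.
  by rewrite -(opprD 1%:Z) mulrNz -[1 + j%:Z]/(j.+1%:Z) -pmulrn; ring.
by rewrite mulrA mulrA -exprD addnn -mul2n exprM sqrrN !expr1n mul1r divff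
  // pnatr_eq0 -lt0n fact_gt0.
Qed.

End Binomial.

(** * Commutator and associativity formulas *)

Section WeakModule.
Variables (R : realType) (V : voa R) (M : weak_module V).
Implicit Types (u v : V) (w : M).

HB.instance Definition _ u n :=
  GRing.isLinear.Build R[i] M M _ (@act R V M u n) ((act_bilinear M).1 u n).

Definition actl n w u : M := act u n w.

HB.instance Definition _ n w :=
  GRing.isLinear.Build R[i] V M _ (actl n w) ((act_bilinear M).2 n w).

Lemma act0l n w : act (0 : V) n w = 0.
Proof. exact: (linear0 (actl n w)). Qed.

Lemma act_trunc_nat u w : exists K : nat, forall n : int, K%:Z <= n -> act u n w = 0.
Proof.
have [N hN] := act_truncation u w; exists `|N|%N => n Nn; apply: hN; lia.
Qed.

(** The Jacobi identity at [l = 0], where only [i = 0] survives on the left. Any large enough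
    cut-off [K] is allowed, so that it can be chosen to fit each use. *)
Lemma act_comm u v (m n : int) w : exists K0 : nat, forall K, (K0 <= K)%N ->
  act u m (act v n w) - act v n (act u m w) =
    \sum_(i < K) binz _ m i *: act (mode u i%:Z v) (m + n - i%:Z) w.
Proof.
have [N hN] := mode_truncation u v; exists `|N|%N => K NK.
have := act_jacobi u v w 0 m n.
rewrite (@fsbig_nat_ord _ _ _ 1) => [|i i_gt0]; last first.
  by rewrite binz0l gtn_eqF // mulr0 scale0r.
rewrite big_ord1 /= binz0 expr0 expr0z mulr1 !scale1r !addr0 => ->.
rewrite (@fsbig_nat_ord _ _ _ K) => [|i Ki].
  by [].

by rewrite -[0 + i%:Z]/(i%:Z) hN ?act0l ?scaler0 //; lia.
Qed.

(** The Jacobi identity at [m = 0], where only [i = 0] survives on the right. *)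
Lemma act_assoc u v (l n : int) w : exists K0 : nat, forall K, (K0 <= K)%N ->
  act (mode u l v) n w =
    \sum_(i < K) ((-1) ^+ i * binz _ l i) *:
      (act u (l - i%:Z) (act v (n + i%:Z) w)
       - (-1) ^ l *: act v (n + l - i%:Z) (act u i%:Z w)).
Proof.
have [Ku hu] := act_trunc_nat u w; have [Kv hv] := act_trunc_nat v w.
exists (Ku + Kv + `|n|)%N => K ltK.
have := act_jacobi u v w l 0 n.
rewrite (@fsbig_nat_ord _ _ _ K) => [|i Ki]; last first.
  rewrite hv ?(hu (_ + _)) ?linear0 ?scaler0 ?oppr0 ?addr0 ?scaler0 //; lia.
rewrite [RHS](@fsbig_nat_ord _ _ _ 1) => [|i i_gt0]; last first.
  by rewrite binz0l gtn_eqF // scale0r.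
rewrite big_ord1 /= binz0 scale1r addr0 (add0r n) ?(subr0 n) => <-.
by apply: eq_bigr => i _; rewrite !add0r.
Qed.

(** The modes of the normally ordered product of two fields: at [l = -1] all coefficients and signs
    become 1. *)
Lemma act_assocN1 u v (n : int) w : exists K0 : nat, forall K, (K0 <= K)%N ->
  act (mode u (-1) v) n w =
    \sum_(i < K) (act u (-1 - i%:Z) (act v (n + i%:Z) w)
       + act v (n - 1 - i%:Z) (act u i%:Z w)).
Proof.
have [K0 h] := act_assoc u v (-1) n w; exists K0 => K /h ->.
apply: eq_bigr => i _; rewrite binzN1 scale1r exprN1 invrN1 scaleN1r opprK.
by [].
Qed.

(* The field of a_(-1-t)1 is the t-th divided derivative of the field of a. *)
Lemma act_divided_derivative u (t k : nat) : exists2 c : R[i], c != 0 &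
  forall w, act (mode u (-1 - t%:Z) (vac V)) (-1 - k%:Z) w
    = c *: act u (-1 - t%:Z - k%:Z) w.
Proof.
exists ((-1) ^+ k * binz R[i] (- 1 - t%:Z) k).
  by rewrite mulf_neq0 ?binz_neg_neq0 // signr_eq0.
move=> w; have [K0 h] := act_assoc u (vac V) (-1 - t%:Z) (-1 - k%:Z) w.
rewrite (h (K0 + k.+1)%N) ?leq_addr //.
have kK : (k < K0 + k.+1)%N by lia.
(* The vacuum acts only through its mode -1. The first products meet it at [i = k] alone; the second
   ones carry the mode [-2 - t - k - i], which is never -1. *)
rewrite (bigD1 (Ordinal kK)) //= !act_vac subrK eqxx.
rewrite ifF ?scaler0 ?subr0; last by apply/eqP; lia.
rewrite big1 ?addr0 // => i /eqP ik.
rewrite !act_vac ifF ?linear0; last first.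
  by apply/eqP => e; apply: ik; apply: val_inj => /=; lia.
rewrite ifF ?scaler0 ?subr0 ?scaler0 //.
by apply/eqP; lia.
Qed.

End WeakModule.

(** * Weights of modes, and homogeneous generators modulo C_2(V) *)

Section Weights.
Variables (R : realType) (V : voa R).
Implicit Types u v : V.

Lemma homogE (k : int) v : voa_homog k v = (voa_L 0 v = k%:~R *: v).
Proof. by []. Qed.

Lemma voa_L0_linear : linear (voa_L 0 : V -> V).
Proof. exact: (mode_bilinear V).1. Qed.

Lemma homog_lin (k : int) a u v :
  voa_homog k u -> voa_homog k v -> voa_homog k (a *: u + v).
Proof.
move=> hu hv.
by rewrite homogE voa_L0_linear hu hv scalerDr !scalerA mulrC.
Qed.

(** Commuting L(0), the mode 1 of [conformal], past u_n gives (L(-1)u)_{n+1} + (L(0)u)_n, and the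
    derivative property turns the first term into -(n+1) u_n. *)
Lemma homog_mode (p q n : int) u v :
  voa_homog p u -> voa_homog q v -> voa_homog (p + q - n - 1) (mode u n v).
Proof.
move=> hu hv; have [K0 h] := @act_comm _ _ (adjoint V) (conformal V) u 1 n v.
have {h} := h K0.+2 (leq_trans (leqnSn _) (leqnSn _)).
rewrite !big_ord_recl big1 => [|i _]; last first.
  by rewrite /binz !big_ord_recl /= subrr mul0r mulr0 mul0r scale0r.
rewrite !lift0 /= binz0 binz1 addr0 !scale1r.
have -> : mode (conformal V) 0%Z u = voa_L (-1) u by [].
have -> : mode (conformal V) 1%Z u = voa_L 0 u by [].
have -> : mode (conformal V) 1 v = voa_L 0 v by [].
rewrite voa_derivative hu hv (addrC 1 n) addrK.
have mZl c : mode (c *: u) n v = c *: mode u n v.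
  exact: (linearZ_LR (@actl _ _ (adjoint V) n v)).
have mZr c : mode u n (c *: v) = c *: mode u n v.
  exact: (linearZ_LR (@act _ _ (adjoint V) u n)).
rewrite mZl mZr.
move/eqP; rewrite subr_eq => /eqP h; rewrite homogE [LHS]h.
rewrite addr0 -!scalerDl -!intrD; congr (_%:~R *: _); ring.
Qed.

Variable hcft : cft_type V.

Lemma homog_vac : voa_homog 0 (vac V).
Proof. by rewrite hcft.2; exists 1; rewrite scale1r. Qed.

Lemma homog_nat (k : int) v : voa_homog k v -> v <> 0 -> exists p : nat, k = p%:Z.
Proof.
by move=> hv v0; case: k hv => [p|p] hv; [exists p|case: v0; apply: hcft.1 hv].
Qed.

(** Each decomposition is an arbitrary choice, so linearity rests on uniqueness ([homog_sum_eq0]),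
    applied over one list containing all three supports. *)
Lemma homog_comp_linear (p : int) : linear (homog_comp p : V -> V).
Proof.
move=> a u v; rewrite /homog_comp.
case: cid => f /= [ff hf fE]; case: cid => g /= [fg hg gE].
case: cid => h /= [fh hh hE].
have /finite_seqP[sf sfE] := ff; have /finite_seqP[sg sgE] := fg.
have /finite_seqP[sh shE] := fh.
pose s := undup (p :: sf ++ sg ++ sh).
have us : uniq s by exact: undup_uniq.
have sum_s (e : int -> V) (t : seq int) : [set k | e k <> 0] = [set` t] ->
    {subset t <= s} -> \sum_(k \in [set: int]) e k = \sum_(k <- s) e k.
  move=> tE ts; rewrite (fsbigE s) //; last first.
    move=> k _ ks; apply: contrapT => ek; have : [set` t] k by rewrite -tE.
    by move/ts; apply/negP.
  by apply: eq_bigl => k; rewrite in_setT.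
have sub : [/\ {subset sf <= s}, {subset sg <= s} & {subset sh <= s}].
  by split=> k ks; rewrite mem_undup inE !mem_cat ks ?orbT.
case: sub => subf subg subh.
rewrite (sum_s _ _ sfE subf) in fE; rewrite (sum_s _ _ sgE subg) in gE.
rewrite (sum_s _ _ shE subh) in hE.
apply/eqP; rewrite -subr_eq0; apply/eqP.
apply: (@homog_sum_eq0 _ _ s (fun k => f k - (a *: g k + h k)) us _ _ p).
- by move=> k; rewrite addrC -scaleN1r; do 2 ?apply: homog_lin.
- by rewrite sumrB big_split -scaler_sumr /= -fE -gE -hE subrr.
- by rewrite mem_undup inE eqxx.
Qed.

HB.instance Definition _ p :=
  GRing.isLinear.Build R[i] V V _ (homog_comp p) (homog_comp_linear p).

Lemma homog_decomp v : exists s : seq (nat * V),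
  (forall l, l \in s -> voa_homog l.1 l.2) /\ v = \sum_(l <- s) l.2.
Proof.
have [f [/finite_seqP[s sE] hf vE]] := voa_grading v.
have fs k : (k \in s) <-> f k <> 0.
  by rewrite -[f k <> 0]/([set k | f k <> 0] k) sE.
exists [seq (absz k, f k) | k <- undup s]; split=> [l|] /=.
  case/mapP=> k; rewrite mem_undup => /fs fk -> /=.
  by have [q kq] := homog_nat (hf _) fk; have := hf k; rewrite kq.
rewrite big_map {1}vE (fsbigE (undup s)) ?undup_uniq //; last first.
  by move=> j _; rewrite mem_undup => /negP js; apply: contrapT => /fs.
by apply: eq_bigl => j; rewrite in_setT.
Qed.

Lemma homog_span (E : lmodType R[i]) (f : V -> E) (I : submodClosed E) :
  linear f -> (forall (p : nat) u, voa_homog p u -> f u \in I) ->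
  forall v, f v \in I.
Proof.
move=> fl fI v; have [s [hs ->]] := homog_decomp v.
pose F : {linear V -> E} := HB.pack f (GRing.isLinear.Build _ V E _ f fl).
rewrite -[f]/(F : V -> E) linear_sum big_seq; apply: rpred_sum => l ls.
by apply: fI (hs l ls).
Qed.

Definition C2_gens (A : seq (nat * V)) (p : nat) : set V :=
  [set x | (p, x) \in A \/ exists (q r : nat) (y z : V),
    [/\ voa_homog q y, voa_homog r z, (q + r + 1)%N = p & x = mode y (-2) z]].

(** [A] collects the homogeneous components of lifts of a finite spanning set of V/C_2(V).
    Projection to weight [p] respects the generators because y_{-2}z is homogeneous for homogeneous
    y and z. *)
Lemma C2_cofinite_gens : C2_cofinite (adjoint V) ->
  exists A : seq (nat * V), (forall l, l \in A -> voa_homog l.1 l.2) /\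
    forall (p : nat) v, voa_homog p v -> v \in lspan (C2_gens A p).
Proof.
move=> /fin_dim_lquotP[d [e span]].
have [s hs] := choice (fun i => homog_decomp (e i)).
exists (flatten [seq s i | i <- enum 'I_d]); split=> [l|p v hv].
  by case/flattenP=> _ /mapP[i _ ->]; apply: (hs i).1.
set A := flatten _.
have -> : v = homog_comp p v by rewrite (homog_compE hv) eqxx.
have compC x : x \in C2 (adjoint V) -> homog_comp p x \in lspan (C2_gens A p).
  apply: lspan_lin (@homog_comp_linear p) _ _ => _ [y [z ->]].
  apply: (@homog_span _ (fun y => homog_comp p (mode y (-2) z))) => [c a b|q {}y hy].
    by rewrite (mode_bilinear V).2 (homog_comp_linear p).
  apply: (@homog_span _ (fun z => homog_comp p (mode y (-2) z))) => [c a b|r {}z hz].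
    by rewrite (mode_bilinear V).1 (homog_comp_linear p).
  rewrite (homog_compE (homog_mode (-2) hy hz)); case: eqP => [pE|]; last first.
    by rewrite rpred0.
  by apply: lspan_gen; right; exists q, r, y, z; split=> //; lia.
have [c hc] := span v; rewrite -(subrK (\sum_i c i *: e i) v) linearD.
apply: rpredD; first exact: compC.
rewrite linear_sum; apply: rpred_sum => i _.
rewrite linearZ rpredZ //= (hs i).2 linear_sum big_seq; apply: rpred_sum => l ls.
rewrite -[X in X \in _]/(homog_comp p l.2) (homog_compE ((hs i).1 l ls)).
case: eqP => [[pE]|]; last by rewrite rpred0.
apply: lspan_gen; left; rewrite pE -surjective_pairing.
by apply/flattenP; exists (s i) => //; rewrite map_f ?mem_enum.
Qed.

End Weights.

(** * Two auxiliary facts on lists *)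

Lemma sum_sqr_le (J : Type) (s : seq J) (f : J -> int) (P : pred J) :
  all P s -> (forall j, P j -> 0 <= f j) ->
  \sum_(j <- s) f j ^+ 2 <= (\sum_(j <- s) f j) ^+ 2.
Proof.
move=> Ps f0; suff : 0 <= \sum_(j <- s) f j /\
  \sum_(j <- s) f j ^+ 2 <= (\sum_(j <- s) f j) ^+ 2 by case.
elim: s Ps => [|j s IH] /=; first by rewrite !big_nil expr0n.
move=> /andP[/f0 fj /IH[s0 sle]]; rewrite !big_cons; split; first exact: addr_ge0.
by rewrite sqrrD lerD // lerDl mulrn_wge0 ?mulr_ge0.
Qed.

Lemma not_uniq_map (T T' : eqType) (f : T -> T') (s : seq T) :
  ~~ uniq (map f s) -> exists a b t, perm_eq s (a :: b :: t) /\ f a = f b.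
Proof.
elim: s => [//|a s IH] /=; rewrite negb_and negbK => /orP[/mapP[b bs fab]|/IH].
  by exists a, b, (rem b s); rewrite perm_cons perm_to_rem.
move=> [b [c [t [st fbc]]]]; exists b, c, (a :: t); split=> //.
by rewrite -[b :: c :: a :: t]/([:: b; c] ++ a :: t) perm_sym perm_catC /= perm_cons
  (perm_trans _ (_ : perm_eq (b :: c :: t) s)) ?(perm_catC t) // perm_sym.
Qed.

(** * Words in modes applied to a fixed vector *)

Section Words.
Variables (R : realType) (V : voa R) (M : weak_module V).
Hypothesis hcft : cft_type V.

(** Weight, vector, mode index. The weight is stored because the vector does not determine it: zero
    has every weight. *)
Definition letter : Type := (nat * V * int)%type.
Implicit Types (s t X Y Z : seq letter) (a b l : letter) (x w : M).

Definition ev s x : M := foldr (fun l => act l.1.2 l.2) x s.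
Definition word_wt s : nat := \sum_(l <- s) l.1.1.
Definition word_deg s : int := \sum_(l <- s) (l.1.1%:Z - l.2 - 1).
Definition homog_word s : bool := all (fun l => `[< voa_homog l.1.1 l.1.2 >]) s.

(** The weight is only bounded while the degree is exact: rewriting may lower the former but
    preserves the latter. *)
Definition wt_deg_word (N : nat) (d : int) s :=
  [&& homog_word s, (word_wt s <= N)%N & word_deg s == d].

Lemma perm_wt_deg_word N d s t : perm_eq s t -> wt_deg_word N d s = wt_deg_word N d t.
Proof.
move=> st; rewrite /wt_deg_word /homog_word (perm_all _ st).
by rewrite /word_wt /word_deg !(perm_big _ st).
Qed.

Lemma ev_linear s : linear (ev s).
Proof. by elim: s => [//|l s IH] c x y /=; rewrite IH linearP. Qed.

HB.instance Definition _ s := GRing.isLinear.Build R[i] M M _ (ev s) (ev_linear s).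

Lemma ev_cat s t x : ev (s ++ t) x = ev s (ev t x).
Proof. exact: foldr_cat. Qed.

Lemma word_deg_cons l s : word_deg (l :: s) = l.1.1%:Z - l.2 - 1 + word_deg s.
Proof. exact: big_cons. Qed.

Lemma word_wt_cons l s : word_wt (l :: s) = (l.1.1 + word_wt s)%N.
Proof. exact: big_cons. Qed.

Lemma word_deg_cat s t : word_deg (s ++ t) = word_deg s + word_deg t.
Proof. exact: big_cat. Qed.

Lemma word_wt_cat s t : word_wt (s ++ t) = (word_wt s + word_wt t)%N.
Proof. exact: big_cat. Qed.

Variable w : M.

(** Weights of modes are computed as integers, letters carry natural ones. CFT type closes the gap
    for nonzero vectors, and a zero vector gives 0. *)
Lemma homog_letter (I : submodClosed M) (k : int) (u : V) m X Z :
  voa_homog k u -> (forall p : nat, k = p%:Z -> ev (X ++ (p, u, m) :: Z) w \in I) ->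
  ev X (act u m (ev Z w)) \in I.
Proof.
move=> hu hI; have [->|/eqP u0] := eqVneq u 0.
  by rewrite act0l linear0 rpred0.
have [p kp] := homog_nat hcft hu u0.
by have := hI p kp; rewrite ev_cat.
Qed.

Variable A : seq (nat * V).

Definition A_word s : bool := all (fun l => l.1 \in A) s.

Definition increasing s : bool := sorted (fun l m : letter => l.2 < m.2) s.

(** The degree belongs to words, not to vectors of [M]: one vector may lie in these spans for
    several [d]. *)
Definition normal_span (d : int) : submodClosed M :=
  lspan [set x | exists s, [/\ A_word s, increasing s, word_deg s = d & x = ev s w]].

Hypothesis homA : forall g, g \in A -> voa_homog g.1 g.2.
Hypothesis genA : forall (p : nat) v, voa_homog p v -> v \in lspan (C2_gens A p).

Lemma A_word_homog s : A_word s -> homog_word s.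
Proof. by apply: sub_all => l /homA hl; apply/asboolP. Qed.

(** * Rewriting modulo words of lower total weight *)

Section WeightStep.
Variable N : nat.
Hypothesis lower_wt : forall d s,
  homog_word s -> word_deg s = d -> (word_wt s < N)%N -> ev s w \in normal_span d.

(** The commutator consists of modes of u_i v with [i >= 0], of weight [p + q - i - 1 < p + q] and
    unchanged degree, so [lower_wt] absorbs it. *)
Lemma ev_swap d X Z a b : wt_deg_word N d (X ++ a :: b :: Z) ->
  ev (X ++ a :: b :: Z) w - ev (X ++ b :: a :: Z) w \in normal_span d.
Proof.
rewrite /wt_deg_word /homog_word all_cat /= word_wt_cat word_deg_cat.
rewrite !word_wt_cons !word_deg_cons => /and3P[/and4P[hX /asboolP ha /asboolP hb hZ]].
move=> hwt /eqP hd; rewrite !ev_cat -linearB /=.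
have [K0 /(_ _ (leqnn _)) ->] := act_comm a.1.2 b.1.2 a.2 b.2 (ev Z w).
rewrite linear_sum; apply: rpred_sum => i _; rewrite linearZ rpredZ //=.
apply: homog_letter (homog_mode _ ha hb) _ => p pE; apply: lower_wt.
- rewrite /homog_word all_cat /= hX hZ andbT /=; apply/asboolP.
  by rewrite -pE; apply: homog_mode.
- by rewrite word_deg_cat word_deg_cons /= -hd; lia.
- by rewrite word_wt_cat word_wt_cons /=; lia.
Qed.

Lemma ev_front d Y X Z a : wt_deg_word N d (Y ++ X ++ a :: Z) ->
  ev (Y ++ X ++ a :: Z) w - ev (Y ++ a :: X ++ Z) w \in normal_span d.
Proof.
elim: X Y => [|b X IH] Y h; first by rewrite subrr rpred0.
have h1 : wt_deg_word N d (rcons Y b ++ X ++ a :: Z) by rewrite cat_rcons.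
have h2 : wt_deg_word N d (Y ++ b :: a :: X ++ Z).
  rewrite -(perm_wt_deg_word _ _ (_ : perm_eq (Y ++ (b :: X) ++ a :: Z) _)) //.
  by rewrite perm_cat2l /= perm_cons -cat1s perm_catCA.
have := rpredD (IH _ h1) (ev_swap h2).
by rewrite !cat_rcons addrA subrK.
Qed.

Lemma ev_perm_sub d Y s t : perm_eq s t -> wt_deg_word N d (Y ++ s) ->
  ev (Y ++ s) w - ev (Y ++ t) w \in normal_span d.
Proof.
elim: s Y t => [|a s IH] Y t st h.
  by move: st; rewrite perm_sym => /perm_nilP->; rewrite subrr rpred0.
have at_ : a \in t by rewrite -(perm_mem st) inE eqxx.
case/splitPr: at_ st => t1 t2 st.
have h2 : wt_deg_word N d (Y ++ t1 ++ a :: t2).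
  by rewrite -(perm_wt_deg_word _ _ (_ : perm_eq (Y ++ (a :: s)) _)) // perm_cat2l.
have st' : perm_eq s (t1 ++ t2).
  by rewrite -(perm_cons a) (perm_trans st) // -cat1s perm_catCA.
have h1 : wt_deg_word N d (rcons Y a ++ s) by rewrite cat_rcons.
have := submodB (IH _ _ st' h1) (ev_front h2).
by rewrite !cat_rcons opprB addrA subrK.
Qed.

Lemma ev_perm d s t : perm_eq s t -> wt_deg_word N d s ->
  (ev s w \in normal_span d) = (ev t w \in normal_span d).
Proof. by move=> st h; apply/submod_congr/(@ev_perm_sub d [::]). Qed.

(** Induction on the number of letters outside [A]. One of them is moved to the front and expanded
    by [genA]: members of [A] lower the count, and y_{-2}z splits by associativity into words of
    lower weight. *)
Lemma reduce_to_A (d : int) k :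
  (forall s, A_word s -> wt_deg_word N d s -> size s = k -> ev s w \in normal_span d) ->
  forall s, wt_deg_word N d s -> size s = k -> ev s w \in normal_span d.
Proof.
move=> HA s; have [m] := ubnP (count (fun l => l.1 \notin A) s).
elim: m s => [//|m IH] s /= hm hs ks; have [As|] := boolP (A_word s).
  exact: HA.
rewrite -has_predC => notA.
have [[[p u] n] us uA] : exists2 l : letter, l \in s & l.1 \notin A by apply/hasP.
have st := perm_to_rem us; rewrite (ev_perm st hs) /=.
move: hm hs ks; rewrite (permP st) (perm_wt_deg_word _ _ st) (perm_size st) /= uA add1n ltnS.
set t := rem _ s => hm /and3P[/= /andP[/asboolP hu ht]].
rewrite word_wt_cons word_deg_cons /= => hwt /eqP hd [kt].
apply: (lspan_lin (f := fun v => act v n (ev t w))) (genA hu) => [|x].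
  exact: (act_bilinear M).2.
case=> [xA|[q [r [y [z [hy hz pE ->]]]]]].
  apply: (IH ((p, x, n) :: t)) => /=; first by rewrite xA add0n.
    rewrite /wt_deg_word /= word_wt_cons word_deg_cons hwt hd eqxx ht !andbT.
    by apply/asboolP/(homA xA).
  by rewrite kt.
have low y' z' (q' r' : nat) i j : voa_homog q' y' -> voa_homog r' z' ->
    (q' + r' + 1)%N = p -> i + j = n - 2 ->
    act y' i (act z' j (ev t w)) \in normal_span d.
  move=> hy' hz' pE' ij.
  apply: (@lower_wt d ((q', y', i) :: (r', z', j) :: t)).
  - rewrite /homog_word /= -[all _ t]/(homog_word t) ht andbT.
    by apply/andP; split; apply/asboolP.
  - by rewrite !word_deg_cons -hd /=; lia.
  - by rewrite !word_wt_cons /=; lia.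
have [K0 /(_ _ (leqnn _)) ->] := act_assoc y z (-2) n (ev t w).
apply: rpred_sum => i _; rewrite rpredZ // submodB ?rpredZ //.
  by apply: low hy hz pE _; lia.
by apply: low hz hy _ _; lia.
Qed.

Variable T : nat.
Hypothesis truncA : forall g (n : int), g \in A -> T%:Z <= n -> act g.2 n w = 0.

(** * Removing repeated indices by induction on length *)

Section LengthStep.
Variable k : nat.
Hypothesis shorter : forall (d : int) s,
  wt_deg_word N d s -> (size s < k)%N -> ev s w \in normal_span d.

(** Replacing an index pair (r, r) by (i, j) with i + j = 2r and i different from r fixes [depth]
    and raises [depth_sqr] by 2(i - r)^2. *)
Definition depth_sqr s : int := \sum_(l <- s) (T%:Z - l.2) ^+ 2.
Definition depth s : int := \sum_(l <- s) (T%:Z - l.2).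

Lemma A_word_mem (d : int) s : A_word s -> wt_deg_word N d s -> size s = k ->
  ev s w \in normal_span d.
Proof.
(* When all indices are below [T], [sum_sqr_le] makes the difference nonnegative. The [+ 1] then
   keeps the measure positive, so it drops even when the next value is clipped to 0. *)
have [m] := ubnP (absz (Num.max 0 (depth s ^+ 2 - depth_sqr s + 1))).
elim: m s => [//|m IH] s hm As hs ks.
(* A letter of index at least [T] kills [w] once it is moved to the right end. *)
have [/hasP[a sa Ta]|] := boolP (has (fun l => T%:Z <= l.2) s).
  have st := perm_to_rem sa.
  have st' : perm_eq s (rem a s ++ [:: a]) by rewrite (perm_trans st) // -cat1s perm_catC.
  rewrite (ev_perm st' hs) ev_cat /= truncA ?linear0 ?rpred0 //.
  exact: (allP As).
rewrite -all_predC => all_lt.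
have sq_le : depth_sqr s <= depth s ^+ 2.
  by apply: sum_sqr_le all_lt _ => l /=; lia.
have [us|nus] := boolP (uniq [seq l.2 | l <- s]).
  pose le := fun l m : letter => l.2 <= m.2.
  have st : perm_eq s (sort le s) by rewrite perm_sym perm_sort.
  rewrite (ev_perm st hs); apply: lspan_gen; exists (sort le s); split=> //.
  - by rewrite /A_word -(perm_all _ st).
  - have tot : total le by move=> x y; apply: le_total.
    have := sort_sorted tot s.
    rewrite -[sorted le _]/(sorted (relpre snd <=%O) _) -sorted_map => les.
    rewrite -[increasing _]/(sorted (relpre snd <%O) _) -sorted_map.
    rewrite lt_sorted_uniq_le les andbT.
    by rewrite (perm_uniq (_ : perm_eq _ [seq l.2 | l <- s])) // perm_map // perm_sym.
  - by move: hs; rewrite (perm_wt_deg_word _ _ st) => /and3P[_ _ /eqP].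
have [[[p u] r] [[[q v] r'] [t [st /= ab]]]] : exists (a b : letter) (t : seq letter),
  perm_eq s (a :: b :: t) /\ a.2 = b.2 by exact: not_uniq_map.
rewrite -{r'}ab in st; rewrite (ev_perm st hs).
move: hs As ks hm sq_le {all_lt}; rewrite (perm_wt_deg_word _ _ st) /A_word.
rewrite (perm_all _ st) (perm_size st).
rewrite /depth /depth_sqr !(perm_big _ st) {nus s st}.
rewrite !big_cons /= => hs /and3P[uA vA tA] kE hm sq_le.
have [hwt hd ht] : [/\ (p + q + word_wt t <= N)%N,
    p%:Z + q%:Z - r *+ 2 - 2 + word_deg t = d & homog_word t].
  case/and3P: hs => /and3P[_ _ ht]; rewrite !word_wt_cons !word_deg_cons /=.
  by move=> hwt /eqP <-; split=> //; lia.
have other (x y : nat * V) (i j : int) : i + j = r *+ 2 -> i <> r ->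
    (x = (p, u) /\ y = (q, v)) \/ (x = (q, v) /\ y = (p, u)) ->
    act x.2 i (act y.2 j (ev t w)) \in normal_span d.
  move=> ij ir xy.
  have xyE : [/\ x \in A, y \in A & (x.1 + y.1 = p + q)%N].
    by case: xy => -[-> ->]; split=> //; apply: addnC.
  case: xyE => xA yA xyE.
  apply: (IH ((x, i) :: (y, j) :: t)); last by rewrite -kE.
  - rewrite /depth /depth_sqr !big_cons /=.
    have -> : T%:Z - i + (T%:Z - j + \sum_(l <- t) (T%:Z - l.2)) =
              T%:Z - r + (T%:Z - r + \sum_(l <- t) (T%:Z - l.2)) by lia.
    have sqr_gt : (T%:Z - r) ^+ 2 + (T%:Z - r) ^+ 2 < (T%:Z - i) ^+ 2 + (T%:Z - j) ^+ 2.
      have -> : j = r *+ 2 - i by lia.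
      have -> : (T%:Z - i) ^+ 2 + (T%:Z - (r *+ 2 - i)) ^+ 2 =
        (T%:Z - r) ^+ 2 + (T%:Z - r) ^+ 2 + (i - r) ^+ 2 *+ 2 by ring.
      by rewrite ltrDl pmulrn_lgt0 // exprn_even_gt0 // subr_eq0; apply/eqP.
    move: sqr_gt hm sq_le.
    move: (_ ^+ 2) (_ ^+ 2) (_ ^+ 2) => x1 x2 x3; rewrite /Num.max.
    set D := _ ^+ 2; set S2 := \sum_(_ <- _) _; move: D S2 => D S2.
    by do 2 case: ifP; lia.
  - by rewrite /A_word /= xA yA.
  - rewrite /wt_deg_word /= !word_wt_cons !word_deg_cons /= -/(homog_word t) ht.
    rewrite andbT -andbA; apply/and4P; split; try exact/asboolP/homA; lia.
(* The mode 2r + 1 makes every product in the expansion have index sum 2r. The cut-off exceeds the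
   absolute value of r, so the product with both indices r is within range. *)
have [K0 h] := act_assocN1 u v (r *+ 2 + 1) (ev t w).
have {h} := h (K0 + `|r|.+1)%N (leq_addr _ _).
set K := (K0 + _)%N => h.
(* The weight stays [p + q] here; it is the length that drops. *)
have: act (mode u (-1) v) (r *+ 2 + 1) (ev t w) \in normal_span d.
  have hu : voa_homog p u := homA uA; have hv : voa_homog q v := homA vA.
  apply: (@homog_letter _ _ _ _ [::] t (homog_mode (-1) hu hv)) => p2 pE.
  apply: shorter; last by rewrite -kE.
  rewrite /wt_deg_word /= word_wt_cons word_deg_cons /= -/(homog_word t) ht andbT.
  apply/and3P; split; first by apply/asboolP; rewrite -pE; apply: homog_mode.
    by lia.
  by apply/eqP; lia.
(* The index pair (r, r) occurs exactly once: as v_r u_r in the second sum if r >= 0, and as u_r v_r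
   in the first sum, at i = -1 - r, if r < 0. *)
rewrite h {h} big_split /=; have [r0|r0] := leP 0 r.
  have rK : (absz r < K)%N by rewrite /K; lia.
  rewrite [X in _ + X](bigD1 (Ordinal rK)) //= addrCA.
  rewrite (@submod_congr _ _ _ _ (ev [:: (q, v, r), (p, u, r) & t] w)).
    rewrite (@ev_perm d [:: (p, u, r), (q, v, r) & t] [:: (q, v, r), (p, u, r) & t]) //.
    by rewrite -(cat1s (p, u, r)) -(cat1s (q, v, r)) perm_catCA.
  have -> : act v (r *+ 2 + 1 - 1 - `|r|%N%:Z) (act u `|r|%N%:Z (ev t w)) =
      ev [:: (q, v, r), (p, u, r) & t] w by rewrite gez0_abs //=; congr act; lia.
  rewrite addrAC subrr add0r rpredD //; apply: rpred_sum => i.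
    by move=> _; apply: (other (p, u) (q, v)); [lia|lia|left].
  move=> /eqP ir; apply: (other (q, v) (p, u)); [lia| |by right].
  by move=> ir'; apply: ir; apply: val_inj => /=; lia.
have rK : (`|(- 1 - r)%R| < K)%N by rewrite /K; lia.
rewrite (bigD1 (Ordinal rK)) //= -addrA.
rewrite (@submod_congr _ _ _ _ (ev [:: (p, u, r), (q, v, r) & t] w)) //.
have -> : act u (-1 - `|(- 1 - r)%R|%N%:Z)
      (act v (r *+ 2 + 1 + `|(- 1 - r)%R|%N%:Z) (ev t w)) =
    ev [:: (p, u, r), (q, v, r) & t] w.
  by rewrite gez0_abs /=; [congr (act _ _ (act _ _ _))|]; lia.
rewrite addrAC subrr add0r rpredD //; apply: rpred_sum => i.
  move=> /eqP ir; apply: (other (p, u) (q, v)); [lia| |by left].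
  by move=> ir'; apply: ir; apply: val_inj => /=; lia.
by move=> _; apply: (other (q, v) (p, u)); [lia|lia|right].
Qed.
End LengthStep.

End WeightStep.

(** * Reduction of arbitrary words to increasing ones *)

Section Spanning.
Variable T : nat.
Hypothesis truncA : forall g (n : int), g \in A -> T%:Z <= n -> act g.2 n w = 0.

(** Splitting y_{-2}z lengthens a word but lowers its weight; contracting to u_{-1}v keeps the
    weight but shortens the word. Hence the induction is on weight first, then on length. *)
Lemma word_normal_span s : homog_word s -> ev s w \in normal_span (word_deg s).
Proof.
suff H N d t : wt_deg_word N d t -> ev t w \in normal_span d.
  by move=> hs; apply: (H (word_wt s)); rewrite /wt_deg_word hs leqnn eqxx.
elim/ltn_ind: N d t => N IHN d t.
have lower d' s' : homog_word s' -> word_deg s' = d' -> (word_wt s' < N)%N ->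
    ev s' w \in normal_span d'.
  by move=> hs' hd' hN; apply: (IHN _ hN); rewrite /wt_deg_word hs' hd' leqnn eqxx.
have [k] := ubnPleq (size t); elim/ltn_ind: k d t => k IHk d t tk ht.
apply: (reduce_to_A lower _ ht (erefl _)) => s' As' hs' ks'.
apply: (A_word_mem lower truncA _ As' hs' ks') => d' s2 hs2 sk.
by apply: (IHk (size s2)) hs2 => //; apply: leq_trans sk tk.
Qed.

End Spanning.
End Words.

(** * Enumeration of words of bounded length *)

Fixpoint words_upto (T : Type) (L : seq T) (k : nat) : seq (seq T) :=
  if k is k'.+1 then [::] :: [seq l :: s | l <- L, s <- words_upto L k']
  else [:: [::]].

Lemma mem_words_upto (T : eqType) (L s : seq T) (k : nat) :
  {subset s <= L} -> (size s <= k)%N -> s \in words_upto L k.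
Proof.
elim: k s => [|k IH] [|l s] //= sL sk.
rewrite inE; apply/allpairsP; exists (l, s); split=> //=.
  by apply: sL; rewrite inE eqxx.
by apply: IH => // x xs; apply: sL; rewrite inE xs orbT.
Qed.

(** * Generation of [M] from [w], and bounds on increasing words *)

Section Generation.
Variables (R : realType) (V : voa R) (M : weak_module V) (w : M).
Hypothesis hcft : cft_type V.

(** The span contains [w] and is stable under all modes, so irreducibility makes it all of [M]. *)
Lemma words_span : irreducible M -> w <> 0 -> forall x : M,
  x \in lspan [set x | exists s : seq (letter V), homog_word s /\ x = ev s w].
Proof.
move=> [_ irr] w0; set W := lspan _.
have Ww : w \in W by apply: lspan_gen; exists [::].
case: (irr W) => // [|v n x|/(_ w Ww)//]; first exact: lspan_submod.
apply: lspan_lin; first exact: (act_bilinear M).1.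
move=> _ [s [hs ->]].
apply: (homog_span hcft (f := fun v => act v n (ev s w))) => [|p u hu].
  exact: (act_bilinear M).2.
apply: lspan_gen; exists ((p, u, n) :: s); split=> //=.
by rewrite hs andbT; apply/asboolP.
Qed.

Lemma common_truncation (A : seq (nat * V)) : exists T : nat,
  forall g (n : int), g \in A -> T%:Z <= n -> act g.2 n w = 0.
Proof.
elim: A => [|a A [T hT]]; first by exists 0%N.
have [K hK] := act_trunc_nat a.2 w; exists (T + K)%N => g n.
by rewrite inE => /orP[/eqP->|gA] Tn; [apply: hK; lia|apply: (hT _ _ gA); lia].
Qed.

Variables (A : seq (nat * V)) (T : nat).
Hypothesis truncA : forall g (n : int), g \in A -> T%:Z <= n -> act g.2 n w = 0.
Implicit Type s : seq (letter V).

(** The last letter acts on [w] itself, so its index is below [T]; the order passes the bound on to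
    the others. *)
Lemma increasing_bounded s : A_word A s -> increasing s -> ev s w <> 0 ->
  all (fun l => l.2 < T%:Z) s.
Proof.
elim: s => [//|a s IH] /= /andP[aA sA] inc ev0.
have ev0' : ev s w <> 0 by move=> e; apply: ev0; rewrite e linear0.
have := IH sA (path_sorted inc) ev0'; case: s inc ev0 {IH sA ev0'} => [_ ev0 _|b s] /=.
  rewrite andbT ltNge; apply/negP => Ta; exact/ev0/(truncA aA).
by move=> /andP[ab _] _ /andP[bT ->]; rewrite bT (lt_trans ab bT).
Qed.

Lemma increasing_uniq s : increasing s -> uniq [seq l.2 | l <- s].
Proof.
rewrite -[increasing _]/(sorted (relpre snd <%O) _) -sorted_map.
exact: lt_sorted_uniq.
Qed.

(** A letter of negative index adds at least 0 to the degree, one of index in [0, T) at least -T.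
    Distinctness leaves at most T of the latter. *)
Lemma word_deg_ge s : increasing s -> all (fun l => l.2 < T%:Z) s ->
  - (T * T)%N%:Z <= word_deg s.
Proof.
move=> inc ltT; pose pos := [seq x <- [seq l.2 | l <- s] | 0 <= x].
have pos_le : (size pos <= T)%N.
  rewrite -[leqRHS](size_iota 0) -(size_map Posz (iota 0 T)).
  apply: uniq_leq_size => [|x]; first exact: filter_uniq (increasing_uniq inc).
  rewrite mem_filter => /andP[x0 /mapP[l ls xl]].
  have := allP ltT l ls; rewrite -xl => xT.
  by apply/mapP; exists `|x|%N; rewrite ?mem_iota ?gez0_abs //; lia.
have : - (T * size pos)%N%:Z <= word_deg s.
  rewrite /pos; elim: s ltT {inc pos pos_le} => [|l s IH] /=.
    by rewrite muln0 /word_deg big_nil.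
  move=> /andP[lT /IH]; rewrite word_deg_cons; case: ifP => /= l0; last lia.
  by rewrite mulnS; lia.
by apply: le_trans; rewrite lerN2 lez_nat leq_mul2l pos_le orbT.
Qed.

(** The indices in [L] run from -m to T - 1. An increasing word repeats no letter, so [size L]
    bounds its length. *)
Definition bounded_words (m : nat) : seq (seq (letter V)) :=
  let L := [seq (g, k%:Z - m%:Z) | g <- A, k <- iota 0 (T + m)] in
  words_upto L (size L).

Lemma increasing_bounded_words (m : nat) s : A_word A s -> increasing s ->
  all (fun l => l.2 < T%:Z) s -> all (fun l => - m%:Z <= l.2) s ->
  s \in bounded_words m.
Proof.
move=> As inc ltT gem; rewrite /bounded_words.
set L := [seq _ | _ <- _, _ <- _]; have sL : {subset s <= L}.
  move=> l ls; apply/allpairsP; exists (l.1, absz (l.2 + m%:Z)).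
  have := allP ltT l ls; have := allP gem l ls => /= lm lT.
  split=> /=; [exact: (allP As) | by rewrite mem_iota; lia |].
  by rewrite [LHS]surjective_pairing gez0_abs ?addrK //; lia.
apply: mem_words_upto => //; apply: uniq_leq_size => //.
exact: map_uniq (increasing_uniq inc).
Qed.



End Generation.

(** * Reduction modulo O_n(M) by induction on the degree *)

Section Reduction.
Variables (R : realType) (V : voa R) (M : weak_module V) (w : M) (n : nat).
Hypothesis hcft : cft_type V.
Variables (A : seq (nat * V)) (T : nat).
Hypothesis homA : forall g, g \in A -> voa_homog g.1 g.2.
Hypothesis genA : forall (p : nat) v, voa_homog p v -> v \in lspan (C2_gens A p).
Hypothesis truncA : forall g (n : int), g \in A -> T%:Z <= n -> act g.2 n w = 0.

Definition reduced_span : submodClosed M :=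
  lspan ([set x : M | exists (u : V) (y : M), x = circ n u y]
         `|` [set` [seq ev s w | s <- bounded_words A T (2 * n + 1)]]).

Lemma normal_span_reduced (d : int) x :
  x \in normal_span w A d -> x \in reduced_span.
Proof.
(* By [word_deg_ge] the measure is positive whenever a nonzero increasing word of degree [d]
   exists. *)
have [m] := ubnP (absz (Num.max 0 (d + (T * T)%N%:Z + 1))).
elim: m d x => [//|m IH] d x hm.
apply: lspan_sub => _ [s [As inc sd ->]].
have [->|/eqP ev0] := eqVneq (ev s w) 0; first exact: rpred0.
have ltT := increasing_bounded truncA As inc ev0.
have d_ge : - (T * T)%N%:Z <= d by rewrite -sd; apply: word_deg_ge.
have [ge_s|] := boolP (all (fun l => - (2 * n + 1)%N%:Z <= l.2) s).
  apply: lspan_gen; right; apply/map_f/increasing_bounded_words => //.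
case: s As inc sd {ev0 ltT} => [//|[[p u] i] s] /= /andP[uA sA] inc sd h.
(* The first index is the smallest, so it violates the bound if any does. *)
have {h} i_lt : i < - (2 * n + 1)%N%:Z.
  rewrite ltNge; apply: contra h => ige; rewrite ige /=.
  apply/allP => l ls; apply: le_trans ige (ltW _).
  by have /allP/(_ l ls) := order_path_min (fun x y z => @lt_trans _ _ _ _ _) inc.
have hu : voa_homog p u := homA uA.
(* The leading mode in [circ n] is always -2n - 2. A lower index [i] is reached through u' =
   u_{-1-t} 1, whose mode -2n - 2 is a nonzero multiple of u_i. *)
have [t iE] : exists t : nat, i = -1 - t%:Z - (2 * n + 1)%N%:Z.
  by exists (absz (- (2 * n + 2)%N%:Z - i)); lia.
pose u' := mode u (-1 - t%:Z) (vac V).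
have hu' : voa_homog (p + t)%N%:Z u'.
  by have := homog_mode (-1 - t%:Z) hu (homog_vac hcft); congr voa_homog; lia.
have [c c0 cE] := act_divided_derivative M u t (2 * n + 1).
rewrite -[X in X \in _]/(act u i (ev s w)).
rewrite -[_ \in _]orFb -(negbTE c0) -rpredZeq iE -cE -/u'.
have circI : circ n u' (ev s w) \in reduced_span.
  by apply: lspan_gen; left; exists u', (ev s w).
move: circI; rewrite (circ_homog _ _ hu').
have [K hK] := act_trunc_nat u' (ev s w).
rewrite (@fsbig_nat_ord _ _ _ (K + 2 * n + 2).+1) => [|j Kj]; last first.
  by rewrite hK ?scaler0 //; lia.
rewrite big_ord_recl /= binz0 scale1r => circI.
rewrite (_ : -1 - _ = 0%N%:Z - (2 * n + 2)%N%:Z); last lia.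
suff rest : forall j : 'I_(K + 2 * n + 2),
    act u' ((bump 0 j)%:Z - (2 * n + 2)%N%:Z) (ev s w) \in reduced_span.
  move: circI; set y := act u' (0%N%:Z - _) _.
  rewrite (submod_congr (y := y)) // addrAC subrr add0r.
  by apply: rpred_sum => j _; rewrite rpredZ // rest.
(* The remaining terms have lower degree, but their first letter u' need not lie in [A] nor respect
   the order; [word_normal_span] first rewrites them as increasing words of the same degree. *)
move=> j; apply: (IH (d - (bump 0 j)%:Z)).
  by move: hm; rewrite /Num.max /bump; do 2 case: ifP; lia.
pose s' := ((p + t)%N, u', (bump 0 j)%:Z - (2 * n + 2)%N%:Z) :: s.
have <- : word_deg s' = d - (bump 0 j)%:Z.
  by rewrite -sd !word_deg_cons /= iE; lia.
apply: (word_normal_span hcft homA genA truncA (s := s')).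
rewrite /homog_word /= -/(homog_word s) (A_word_homog homA sA) andbT.
exact/asboolP.
Qed.

End Reduction.

Theorem corollary5p5 (R : realType) (V : voa R) (M : weak_module V) (n : nat)
  (hV : C2_cofinite (adjoint V)) (hcft : cft_type V) (hM : irreducible M)
  (hC2 : C2_cofinite M) : fin_dim (A_ n M).
Proof.
have [[w w0] _] := hM.
have [A [homA genA]] := C2_cofinite_gens hcft hV.
have [T truncA] := common_truncation w A.
apply: (fin_dim_lquot (s := [seq ev s w | s <- bounded_words A T (2 * n + 1)])) => x.
apply: lspan_sub (words_span hcft hM w0 x) => _ [s [hs ->]].
apply: (normal_span_reduced n hcft homA genA truncA).
exact: (word_normal_span hcft homA genA truncA hs).
Qed.
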